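(* Let $\mathcal{N}^2$ be any expansion, of the kind described in the context, of the standard two-sorted $P(\mathcal{K}_2)$-valued structure $\mathcal{N}^2_0$ of second-order arithmetic. In $\mu[\mathcal{N}^2]$ all the theorems of $\mathsf{EA}^{\circ}$ are valid, and for every modal formula $\varphi(\alpha,\beta)$ in the signature (possibly with further free variables) the following is valid: $$[\Box\,\forall\alpha\,\exists\beta\,\Box\varphi(\alpha,\beta)]\Rightarrow[\exists\gamma\,\Box\,\forall\alpha\,\exists\beta\,(\gamma\alpha=\beta\wedge\Box\varphi(\alpha,\beta))].$$
   Context: Kleene's second model $\mathcal{K}_2$. Its underlying set is Baire space $\omega^{\omega}$. Fix a standard computable coding of finite strings $\omega^{<\omega}$ by natural numbers. For $\alpha,\beta\in\omega^\omega$, $\alpha\beta$ is defined iff for every $n$ there is $\ell$ with $\alpha(((n)^{\frown}\beta)\upharpoonright\ell)\neq0$, and then $(\alpha\beta)(n)=m$ where $\alpha(((n)^{\frown}\beta)\upharpoonright\ell)=m+1$ for the least such $\ell$. This is a partial combinatory algebra (pca): there are elements $k,s$ with $sab$ defined, $kab=a$, $sabc=ac(bc)$ (one side defined iff the other is) for all $a,b,c$; application associates to the left. Fix pairing $p$, projections $p_0,p_1$ with $p_0(pab)=a$, $p_1(pab)=b$, and $\breve{k}$ with $\breve{k}ab=b$. Truth values. Write $\mathcal{A}=\mathcal{K}_2$. For $X,Y\subseteq\mathcal{A}$: $X\wedge Y=\{pab:a\in X,b\in Y\}$, $X\vee Y=\{pka:a\in X\}\cup\{p\breve{k}b:b\in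 Y\}$, $X\Rightarrow Y=\{e:\forall a\in X\;ea\text{ is defined and in }Y\}$, $\bot=\emptyset$, $\top=\mathcal{A}$. For $D\subseteq\mathcal{A}$ put $\ominus_DX=(X\Rightarrow D)\Rightarrow D$. Structure. The language is two-sorted: a number sort (variables $n,m,x,\ldots$) with signature $L_0=\{0,S,f_1,f_2,\ldots\}$ (zero, successor, all primitive recursive functions), a function sort (variables $\alpha,\beta,\gamma,\ldots$), an application function $(\alpha,n)\mapsto\alpha(n)$ to the number sort, and identity on both sorts. In $\mathcal{N}^2_0$ the number sort is $\omega$, the function sort is $\omega^\omega$, function symbols have their standard interpretations, and identity is valued by $\|a=b\|=\top$ if $a=b$ and $\bot$ otherwise (on each sort). The quantifiers are $\mathbb{Q}(n)=\{\alpha\in\omega^\omega:\alpha(0)=n\}$ and $\mathbb{Q}(\alpha)=\{\alpha\}$. An expansion $\mathcal{N}^2$ adds new relation symbols $R$, interpreted by arbitrary maps $\|R(\cdot)\|$ from tuples of elements to $P(\mathcal{K}_2)$, and new function symbols for recursive number-theoretic functions (no new functions defined on function-sort arguments). Modal valuation $\mu[\mathcal{N}^2]$. For each modal formula $\varphi(\overline{x})$, tuple $\overline{a}$ and $D\subseteq\mathcal{A}$, define $\|\varphi(\overline{a})\|_\mu(D)\subseteq\mathcal{A}$ by: atomic $\varphi$: $\ominus_D\|\varphi(\overline{a})\|$; $\bot$: $\ominus_D\bot$; $\wedge$ and $\Rightarrow$ are computed by the operations $\wedge,\Rightarrow$ above; $\|\varphi\vee\psi\|_\mu(D)=\ominus_D(\|\varphi\|_\mu(D)\vee\|\psi\|_\mu(D))$;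 $\|\exists z\,\varphi(z)\|_\mu(D)=\ominus_D\bigcup_c[\mathbb{Q}(c)\wedge\|\varphi(c)\|_\mu(D)]$; $\|\forall z\,\varphi(z)\|_\mu(D)=\bigcap_c[\mathbb{Q}(c)\Rightarrow\|\varphi(c)\|_\mu(D)]$ ($c$ ranging over the sort of $z$); $\|\Box\varphi\|_\mu(D)=\ominus_D\bigcap_{E\subseteq\mathcal{A}}\|\varphi\|_\mu(E)$. A formula $\varphi(\overline{x})$ is valid if there is $e\in\mathcal{A}$ with $e\in(\top\Rightarrow\|\varphi(\overline{a})\|_\mu(D))$ for all $\overline{a}$ and all $D$. $\mathsf{EA}^{\circ}$. This is $Q^{\circ}_{eq}.\mathsf{S4}$ plus Peano arithmetic (successor axioms, defining equations of primitive recursive functions, and induction for all modal formulas of the language). $Q^{\circ}_{eq}.\mathsf{S4}$ has as axioms: classical propositional tautologies; $\Box(\varphi\Rightarrow\psi)\Rightarrow(\Box\varphi\Rightarrow\Box\psi)$; $\Box\varphi\Rightarrow\varphi$; $\Box\varphi\Rightarrow\Box\Box\varphi$; $(\forall x\,\varphi)\Leftrightarrow\varphi$ for $x$ not free in $\varphi$; $[\forall x(\varphi\Rightarrow\psi)]\Rightarrow[(\forall x\,\varphi)\Rightarrow(\forall x\,\psi)]$; $\forall x\forall y\,\varphi\Leftrightarrow\forall y\forall x\,\varphi$; $\forall y((\forall x\,\varphi(x))\Rightarrow\varphi(y))$; $\exists x\,\varphi\Leftrightarrow\neg\forall x\neg\varphi$; $t=t$; $s=t\Rightarrow(\varphi(t)\Rightarrow\varphi(s))$;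 and rules modus ponens, universal generalization, necessitation. In the displayed schema, ''$\gamma\alpha=\beta$'' abbreviates the formula saying that $\gamma$ applied to $\alpha$ in the sense of $\mathcal{K}_2$ is $\beta$: $\forall n\,\exists\ell\,(\gamma(((n)^{\frown}\alpha)\upharpoonright\ell)=\beta(n)+1\wedge\forall\ell_0<\ell\;\gamma(((n)^{\frown}\alpha)\upharpoonright\ell_0)=0)$, where ''$((n)^{\frown}\alpha)\upharpoonright\ell$'' is handled by quantifying existentially over the code of the string in question, characterized by primitive recursive string operations and the values of $\alpha$. *)

(* Defs.v *)
From mathcomp Require Import all_boot.
From mathcomp Require Import boolp classical_sets.

Set Implicit Arguments.
Unset Strict Implicit.
Unset Printing Implicit Defensive.

Local Open Scope classical_set_scope.

(* Finite argument lists are functions out of 'I_n. *)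

Definition fnil {T : Type} : 'I_0 -> T :=
  fun i => False_rect T (notF (ltn_ord i)).

(* Convertible to [ord0] and [lift ord0 i] up to opaque proofs. *)
Definition ofirst {n} : 'I_n.+1 := @Ordinal n.+1 0 isT.
Definition onext {n} (i : 'I_n) : 'I_n.+1 :=
  let: Ordinal m Hm := i in @Ordinal n.+1 m.+1 Hm.

Definition fcons {T : Type} {n} (x : T) (v : 'I_n -> T) : 'I_n.+1 -> T :=
  fun i => let: Ordinal m Hm := i in
    match m return m < n.+1 -> T with
    | 0 => fun _ => x
    | j.+1 => fun Hj => v (@Ordinal n j Hj)
    end Hm.

Definition f1 {T : Type} (x : T) : 'I_1 -> T := fcons x fnil.
Definition f2 {T : Type} (x y : T) : 'I_2 -> T := fcons x (f1 y).
Definition f3 {T : Type} (x y z : T) : 'I_3 -> T := fcons x (f2 y z).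

(** * Kleene's second model *)

Definition baire := nat -> nat.

(* Strings are coded by the library's computable bijection [CodeSeq.code]
   between [seq nat] and [nat]. *)
Definition restr (a : baire) (l : nat) : nat := CodeSeq.code (mkseq a l).

Definition bcons (n : nat) (a : baire) : baire :=
  fun i => if i is j.+1 then a j else n.

(* [K2app a b c]: the product ab is defined and equal to c. *)
Definition K2app (a b c : baire) : Prop :=
  forall n, exists l, a (restr (bcons n b) l) = (c n).+1 /\
    forall l0, l0 < l -> a (restr (bcons n b) l0) = 0.

Definition K2app2 (e a b c : baire) : Prop :=
  exists d, K2app e a d /\ K2app d b c.

(* An arbitrary choice of the combinators entering the truth values. *)
Record combinators := Combinators {
  ck : baire;
  ckb : baire;
  cp : baire;
  cp0 : baire;
  cp1 : baire;
  ckE : forall a b, K2app2 ck a b a;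
  ckbE : forall a b, K2app2 ckb a b b;
  cpE : forall a b, exists c,
    [/\ K2app2 cp a b c, K2app cp0 c a & K2app cp1 c b]
}.

(* Such combinators exist: a function with a modulus of continuity is
   represented by an element of the model. *)
Section CombinatorsExist.

Definition rep1 (N : nat -> nat) (F : baire -> baire) : baire := fun q =>
  if CodeSeq.decode q is m :: t then
    if N m <= size t then (F (nth 0 t) m).+1 else 0
  else 0.

Lemma restrictS n a l : restr (bcons n a) l.+1 = CodeSeq.code (n :: mkseq a l).
Proof. by rewrite /restr /mkseq /= (iotaDl 1 0 l) -map_comp. Qed.

Lemma rep1P N F :
  (forall a b m, (forall i, i < N m -> a i = b i) -> F a m = F b m) ->
  forall a, K2app (rep1 N F) a (F a).
Proof.
move=> FN a n; exists (N n).+1; split=> [|[|l]].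
- rewrite restrictS /rep1 CodeSeq.codeK size_mkseq leqnn; congr _.+1.
  by apply: FN => i lt_i; rewrite nth_mkseq.
- by [].
- by rewrite ltnS restrictS /rep1 CodeSeq.codeK size_mkseq ltnNge => /negbTE ->.
Qed.

Lemma rep2P N (G : baire -> baire -> baire) :
  (forall a a' b b' m, (forall i, i < N m -> a i = a' i) ->
     (forall i, i < N m -> b i = b' i) -> G a b m = G a' b' m) ->
  exists e, forall a b, K2app2 e a b (G a b).
Proof.
move=> GN; pose M q := if CodeSeq.decode q is m :: _ then N m else 0.
exists (rep1 M (fun a => rep1 N (G a))) => a b; exists (rep1 N (G a)); split.
  apply: (@rep1P M (fun a => rep1 N (G a))) => {}a a' q; rewrite /M /rep1.
  by case: CodeSeq.decode => // m t E; rewrite (GN a a' (nth 0 t) (nth 0 t) m E).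
by apply: rep1P => {}b b' m E; apply: GN.
Qed.

Lemma combinators_exist : inhabited combinators.
Proof.
have [k kE] := @rep2P S (fun a b => a) (fun a a' b b' m E _ => E m (leqnn _)).
have [kb kbE] := @rep2P S (fun a b => b) (fun a a' b b' m _ E => E m (leqnn _)).
have [a a' b b' m Ea Eb|p pE] :=
    @rep2P S (fun a b m => if odd m then b m./2 else a m./2).
  by rewrite Ea ?Eb // ltnS leq_half_double -addnn (leq_trans (leq_addr m m)).
have p0E := @rep1P (fun m => m.*2.+1) (fun c m => c m.*2)
  (fun a b m E => E _ (leqnn _)).
have p1E := @rep1P (fun m => m.*2.+2) (fun c m => c m.*2.+1)
  (fun a b m E => E _ (leqnn _)).
constructor; apply: (@Combinators k kb p _ _ kE kbE) => a b.
eexists; split; first exact: pE.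
- have := p0E (fun m => if odd m then b m./2 else a m./2).
  congr (K2app _ _ _); apply: funext => m.
  by rewrite odd_double doubleK.
- have := p1E (fun m => if odd m then b m./2 else a m./2).
  congr (K2app _ _ _); apply: funext => m.
  by rewrite /= odd_double uphalf_double.
Qed.

End CombinatorsExist.

(** * Truth values *)

Section TruthValues.
Variable C : combinators.

Definition tv_and (X Y : set baire) : set baire :=
  [set c | exists a b, [/\ X a, Y b & K2app2 (cp C) a b c]].

Definition tv_or (X Y : set baire) : set baire :=
  [set c | exists2 a, X a & K2app2 (cp C) (ck C) a c] `|`
  [set c | exists2 b, Y b & K2app2 (cp C) (ckb C) b c].

Definition tv_imp (X Y : set baire) : set baire :=
  [set e | forall a, X a -> exists2 c, K2app e a c & Y c].

Definition ominus (D X : set baire) : set baire := tv_imp (tv_imp X D) D.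

End TruthValues.

(** * Primitive recursive and recursive functions *)

(* The symbols of L_0: one for each primitive recursive definition, 0 and S
   being [PZero] and [PSucc]. *)
Inductive primrec : nat -> Type :=
| PZero : primrec 0
| PSucc : primrec 1
| PProj n (i : 'I_n) : primrec n
| PComp m n (g : primrec m) (h : 'I_m -> primrec n) : primrec n
| PRec n (g : primrec n) (h : primrec n.+2) : primrec n.+1.

Fixpoint peval n (f : primrec n) : ('I_n -> nat) -> nat :=
  match f in primrec n return ('I_n -> nat) -> nat with
  | PZero => fun _ => 0
  | PSucc => fun v => (v ofirst).+1
  | PProj _ i => fun v => v i
  | PComp _ _ g h => fun v => peval g (fun i => peval (h i) v)
  | PRec _ g h => fun v =>
      let w := fun i => v (onext i) in
      nat_rec (fun _ => nat) (peval g w)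
        (fun y r => peval h (fcons y (fcons r w))) (v ofirst)
  end.

(* Total recursive functions, by closure under regular minimization. *)
Inductive recursive : forall n, (('I_n -> nat) -> nat) -> Prop :=
| rec_zero : recursive (fun _ : 'I_0 -> nat => 0)
| rec_succ : recursive (fun v : 'I_1 -> nat => (v ofirst).+1)
| rec_proj n (i : 'I_n) : recursive (fun v => v i)
| rec_comp m n (g : ('I_m -> nat) -> nat) (h : 'I_m -> ('I_n -> nat) -> nat) :
    recursive g -> (forall i, recursive (h i)) ->
    recursive (fun v => g (fun i => h i v))
| rec_rec n (g : ('I_n -> nat) -> nat) (h : ('I_n.+2 -> nat) -> nat)
    (f : ('I_n.+1 -> nat) -> nat) :
    recursive g -> recursive h ->
    (forall v, f (fcons 0 v) = g v) ->
    (forall y v, f (fcons y.+1 v) = h (fcons y (fcons (f (fcons y v)) v))) ->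
    recursive f
| rec_min n (g : ('I_n.+1 -> nat) -> nat) (f : ('I_n -> nat) -> nat) :
    recursive g ->
    (forall v, g (fcons (f v) v) = 0 /\
               forall y, y < f v -> g (fcons y v) <> 0) ->
    recursive f.

(** * Language *)

Inductive vsort := Num | Fun.

Definition sort_eqb (s t : vsort) : bool :=
  match s, t with Num, Num | Fun, Fun => true | _, _ => false end.

Definition dom (s : vsort) : Type := match s with Num => nat | Fun => baire end.

(* The symbols added to those of the standard structure. *)
Record signature := Signature {
  fsym : Type;
  farity : fsym -> nat;
  rsym : Type;
  rarity : rsym -> nat;
  rsort : forall R : rsym, 'I_(rarity R) -> vsort
}.

(* Variables are de Bruijn indices, numbered separately for each sort; the
   only terms of the function sort are variables. *)
Inductive term (L : signature) : vsort -> Type :=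
| Var (s : vsort) (i : nat) : term L s
| App (a : term L Fun) (t : term L Num) : term L Num
| Prim n (f : primrec n) (ts : 'I_n -> term L Num) : term L Num
| New (f : fsym L) (ts : 'I_(farity f) -> term L Num) : term L Num.

Arguments Var {L} s i.
Arguments New {L} f ts.

Inductive form (L : signature) : Type :=
| Bot : form L
| Equ (s : vsort) (t u : term L s) : form L
| Rel (R : rsym L) (ts : forall i : 'I_(rarity R), term L (rsort i)) : form L
| And (A B : form L) : form L
| Or (A B : form L) : form L
| Imp (A B : form L) : form L
| All (s : vsort) (A : form L) : form L
| Ex (s : vsort) (A : form L) : form L
| Box (A : form L) : form L.

Arguments Bot {L}.
Arguments Rel {L} R ts.

Definition Neg L (A : form L) : form L := Imp A Bot.
Definition Iff L (A B : form L) : form L := And (Imp A B) (Imp B A).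

(* Pushes [d] as the value of the variable 0 of sort [s]. *)
Definition scons (T : vsort -> Type) (s : vsort) :
    T s -> (forall s', nat -> T s') -> forall s', nat -> T s' :=
  match s with
  | Num => fun d r s' =>
      match s' with
      | Num => fun i => if i is j.+1 then r Num j else d
      | Fun => r Fun
      end
  | Fun => fun d r s' =>
      match s' with
      | Num => r Num
      | Fun => fun i => if i is j.+1 then r Fun j else d
      end
  end.

Definition ren := vsort -> nat -> nat.

Definition shift (s : vsort) : ren :=
  fun s' i => if sort_eqb s s' then i.+1 else i.

Definition upren (s : vsort) (r : ren) : ren :=
  @scons (fun _ => nat) s 0 (fun s' i => shift s s' (r s' i)).

Section Substitution.
Variable L : signature.

Fixpoint tren (r : ren) s (t : term L s) : term L s :=
  match t with
  | Var s i => Var s (r s i)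
  | App a t => App (tren r a) (tren r t)
  | Prim _ f ts => Prim f (fun i => tren r (ts i))
  | New f ts => New f (fun i => tren r (ts i))
  end.

Fixpoint fren (r : ren) (A : form L) : form L :=
  match A with
  | Bot => Bot
  | Equ _ t u => Equ (tren r t) (tren r u)
  | Rel R ts => Rel R (fun i => tren r (ts i))
  | And A B => And (fren r A) (fren r B)
  | Or A B => Or (fren r A) (fren r B)
  | Imp A B => Imp (fren r A) (fren r B)
  | All s A => All s (fren (upren s r) A)
  | Ex s A => Ex s (fren (upren s r) A)
  | Box A => Box (fren r A)
  end.

Definition subst := forall s, nat -> term L s.

Definition upsubst (s : vsort) (f : subst) : subst :=
  scons (Var s 0) (fun s' i => tren (shift s) (f s' i)).

Fixpoint tsubst (f : subst) s (t : term L s) : term L s :=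
  match t with
  | Var s i => f s i
  | App a t => App (tsubst f a) (tsubst f t)
  | Prim _ g ts => Prim g (fun i => tsubst f (ts i))
  | New g ts => New g (fun i => tsubst f (ts i))
  end.

Fixpoint fsubst (f : subst) (A : form L) : form L :=
  match A with
  | Bot => Bot
  | Equ _ t u => Equ (tsubst f t) (tsubst f u)
  | Rel R ts => Rel R (fun i => tsubst f (ts i))
  | And A B => And (fsubst f A) (fsubst f B)
  | Or A B => Or (fsubst f A) (fsubst f B)
  | Imp A B => Imp (fsubst f A) (fsubst f B)
  | All s A => All s (fsubst (upsubst s f) A)
  | Ex s A => Ex s (fsubst (upsubst s f) A)
  | Box A => Box (fsubst f A)
  end.

(* Substitutes [t] for the variable 0 of sort [s], which disappears. *)
Definition inst s (A : form L) (t : term L s) : form L :=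
  fsubst (scons t (fun s' i => Var s' i)) A.

End Substitution.

(** * Structures and the modal valuation *)

(* An expansion of the standard structure by the symbols of [L]. *)
Record expansion (L : signature) := Expansion {
  fint : forall f : fsym L, ('I_(farity f) -> nat) -> nat;
  fint_recursive : forall f, recursive (@fint f);
  rint : forall R : rsym L, (forall i : 'I_(rarity R), dom (rsort i)) -> set baire
}.

Definition env := forall s, nat -> dom s.

Definition Q (s : vsort) : dom s -> set baire :=
  match s with
  | Num => fun n => [set a | a 0 = n]
  | Fun => fun a => [set a]
  end.

Section Semantics.
Variables (C : combinators) (L : signature) (N : expansion L).

Fixpoint teval (r : env) s (t : term L s) : dom s :=
  match t with
  | Var s i => r s i
  | App a t => teval r a (teval r t)
  | Prim _ f ts => peval f (fun i => teval r (ts i))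
  | New f ts => fint N (fun i => teval r (ts i))
  end.

Fixpoint mu (A : form L) (r : env) (D : set baire) : set baire :=
  match A with
  | Bot => ominus D set0
  | Equ _ t u => ominus D [set _ | teval r t = teval r u]
  | Rel R ts => ominus D (rint N (fun i => teval r (ts i)))
  | And A B => tv_and C (mu A r D) (mu B r D)
  | Or A B => ominus D (tv_or C (mu A r D) (mu B r D))
  | Imp A B => tv_imp (mu A r D) (mu B r D)
  | All s A => \bigcap_(c : dom s) tv_imp (Q c) (mu A (scons c r) D)
  | Ex s A => ominus D (\bigcup_(c : dom s) tv_and C (Q c) (mu A (scons c r) D))
  | Box A => ominus D (\bigcap_(E : set baire) mu A r E)
  end.

(* Variables not free in [A] are given values too, which is harmless since
   both sorts are inhabited. *)
Definition valid (A : form L) : Prop :=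
  exists e, forall (r : env) (D : set baire), tv_imp setT (mu A r D) e.

End Semantics.

(** * Epistemic arithmetic *)

Section Arithmetic.
Variable L : signature.
Implicit Types (A B : form L).

Definition tZero : term L Num := Prim PZero fnil.
Definition tSucc (t : term L Num) : term L Num := Prim PSucc (f1 t).

(* Truth value of [A] under an assignment [v] to the formulas whose main
   operator is not propositional. *)
Fixpoint bool_eval (v : form L -> bool) A : bool :=
  match A with
  | Bot => false
  | And A B => bool_eval v A && bool_eval v B
  | Or A B => bool_eval v A || bool_eval v B
  | Imp A B => bool_eval v A ==> bool_eval v B
  | _ => v A
  end.

Definition tautology A : Prop := forall v, bool_eval v A.

Inductive EA : form L -> Prop :=
| ax_taut A : tautology A -> EA A
| ax_K A B : EA (Imp (Box (Imp A B)) (Imp (Box A) (Box B)))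
| ax_T A : EA (Imp (Box A) A)
| ax_4 A : EA (Imp (Box A) (Box (Box A)))
| ax_vacuous s A : EA (Iff (All s (fren (shift s) A)) A)
| ax_all_imp s A B : EA (Imp (All s (Imp A B)) (Imp (All s A) (All s B)))
(* When s <> s' the two variables have independent indices; when s = s' the
   permutation exchanges the indices 0 and 1. *)
| ax_all_perm s s' A :
    EA (Iff (All s (All s' A))
            (All s' (All s
               (fsubst (scons (Var s' (shift s s' 0))
                       (scons (Var s 0)
                       (fun u i => Var u (shift s u (shift s' u i))))) A))))
(* In [A], index 0 is x and index 1 is y (y may occur in A). *)
| ax_inst s A : EA (All s (Imp (All s A) (inst A (Var s 0))))
| ax_ex s A : EA (Iff (Ex s A) (Neg (All s (Neg A))))
| ax_refl s (t : term L s) : EA (Equ t t)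
| ax_subst s (t u : term L s) A : EA (Imp (Equ u t) (Imp (inst A t) (inst A u)))
| ax_succ_neq0 t : EA (Neg (Equ (tSucc t) tZero))
| ax_succ_inj t u : EA (Imp (Equ (tSucc t) (tSucc u)) (Equ t u))
| ax_proj n (i : 'I_n) ts : EA (Equ (Prim (PProj i) ts) (ts i))
| ax_comp m n (g : primrec m) (h : 'I_m -> primrec n) ts :
    EA (Equ (Prim (PComp g h) ts) (Prim g (fun i => Prim (h i) ts)))
| ax_rec0 n (g : primrec n) h ts :
    EA (Equ (Prim (PRec g h) (fcons tZero ts)) (Prim g ts))
| ax_recS n (g : primrec n) h t ts :
    EA (Equ (Prim (PRec g h) (fcons (tSucc t) ts))
           (Prim h (fcons t (fcons (Prim (PRec g h) (fcons t ts)) ts))))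
| ax_ind A :
    EA (Imp (And (inst A tZero)
                 (All Num (Imp A (fsubst (scons (tSucc (Var Num 0))
                                   (fun s i => Var s (shift Num s i))) A))))
            (All Num A))
| ax_mp A B : EA (Imp A B) -> EA A -> EA B
| ax_gen s A : EA A -> EA (All s A)
| ax_nec A : EA A -> EA (Box A).

End Arithmetic.

(** * Primitive recursive string operations *)

Local Notation pj n i := (PProj (@Ordinal n i isT)).
Local Notation pc0 g := (PComp g fnil).
Local Notation pc1 g a := (PComp g (f1 a)).
Local Notation pc2 g a b := (PComp g (f2 a b)).
Local Notation pc3 g a b c := (PComp g (f3 a b c)).

Definition p_isz : primrec 1 := PRec (pc1 PSucc PZero) (pc0 PZero).
Definition p_pred : primrec 1 := PRec PZero (pj 2 0).
Definition p_sub : primrec 2 :=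
  pc2 (PRec (pj 1 0) (pc1 p_pred (pj 3 1))) (pj 2 1) (pj 2 0).
Definition p_if : primrec 3 := PRec (pj 2 1) (pj 4 2).
Definition p_add : primrec 2 := PRec (pj 1 0) (pc1 PSucc (pj 3 1)).
Definition p_odd : primrec 1 := PRec PZero (pc1 p_isz (pj 2 1)).
Definition p_half : primrec 1 :=
  PRec PZero (pc2 p_add (pc1 p_odd (pj 2 0)) (pj 2 1)).

(* In binary, [CodeSeq.code (n :: s)] is the code of s followed by a digit 1
   and n digits 0.  [p_strip] of (k, v) halves v as long as it is even, at
   most k times, and [p_zeros] of (k, v) counts these halvings. *)
Definition p_strip : primrec 2 :=
  PRec (pj 1 0)
    (pc3 p_if (pc1 p_odd (pj 3 1)) (pj 3 1) (pc1 p_half (pj 3 1))).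
Definition p_zeros : primrec 2 :=
  PRec (pc0 PZero)
    (pc2 p_add (pc1 p_isz (pc1 p_odd (pc2 p_strip (pj 3 0) (pj 3 2))))
               (pj 3 1)).
Definition p_head : primrec 1 := pc2 p_zeros (pj 1 0) (pj 1 0).
Definition p_tail : primrec 1 :=
  pc1 p_half (pc2 p_strip (pj 1 0) (pj 1 0)).
Definition p_drop : primrec 2 := PRec (pj 1 0) (pc1 p_tail (pj 3 1)).
(* The number of nonempty strings among the first k iterated tails of v. *)
Definition p_count : primrec 2 :=
  PRec (pc0 PZero)
    (pc2 p_add (pc1 p_isz (pc1 p_isz (pc2 p_drop (pj 3 0) (pj 3 2))))
               (pj 3 1)).
Definition p_len : primrec 1 := pc2 p_count (pj 1 0) (pj 1 0).
Definition p_nth : primrec 2 := pc1 p_head (pc2 p_drop (pj 2 1) (pj 2 0)).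

Local Notation v0 v := (v ofirst).
Local Notation v1 v := (v (onext ofirst)).
Local Notation v2 v := (v (onext (onext ofirst))).

Lemma peval_isz v : peval p_isz v = (v0 v == 0).
Proof. by rewrite /=; case: (v _). Qed.

Lemma peval_pred v : peval p_pred v = (v0 v).-1.
Proof. by rewrite /=; case: (v _). Qed.

Lemma peval_sub v : peval p_sub v = v0 v - v1 v.
Proof.
rewrite /=; elim: (v1 v) => [|y IH] /=; first by rewrite subn0.
by rewrite IH subnS; case: (_ - _).
Qed.

Lemma peval_if v : peval p_if v = if v0 v is 0 then v2 v else v1 v.
Proof. by rewrite /=; case: (v0 v). Qed.

Lemma peval_add v : peval p_add v = v0 v + v1 v.
Proof. by rewrite /=; elim: (v0 v) => //= y ->. Qed.

Lemma peval_odd v : peval p_odd v = odd (v0 v).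
Proof. by rewrite /=; elim: (v0 v) => //= y ->; case: odd. Qed.

Opaque p_isz p_pred p_sub p_if p_add p_odd.

Lemma peval_half v : peval p_half v = (v0 v)./2.
Proof.
rewrite /=; elim: (v0 v) => //= y ->.
by rewrite peval_add /= peval_odd /= uphalf_half.
Qed.

Opaque p_half.

Lemma peval_strip v :
  peval p_strip v = iter (v0 v) (fun r => if odd r then r else r./2) (v1 v).
Proof.
rewrite /=; elim: (v0 v) => //= y ->.
by rewrite peval_if /= peval_odd peval_half /=; case: odd.
Qed.

Opaque p_strip.

Lemma iter_strip n m k :
  iter k (fun r => if odd r then r else r./2) (2 ^ n * m.*2.+1)
  = 2 ^ (n - k) * m.*2.+1.
Proof.
elim: k => [|k IH]; first by rewrite subn0.
rewrite iterS IH subnS; case: (n - k) => [|j].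
  by rewrite expn0 mul1n oddS odd_double.
by rewrite expnS -mulnA mul2n odd_double doubleK.
Qed.

Lemma peval_zeros v n m : v1 v = 2 ^ n * m.*2.+1 ->
  peval p_zeros v = minn (v0 v) n.
Proof.
move=> Ev; rewrite /=; elim: (v0 v) => [|y IH]; first by rewrite min0n.
rewrite /= IH peval_add /= peval_isz /= peval_odd /= peval_strip /= Ev.
rewrite iter_strip; case: (leqP n y) => [le_ny|lt_yn].
  have ->: n - y = 0 by apply/eqP.
  by rewrite expn0 mul1n oddS odd_double (minn_idPr (leqW le_ny)).
have [j ->]: exists j, n - y = j.+1 by case: (n - y) (subn_gt0 y n) => [|j];
  [rewrite lt_yn | exists j].
by rewrite expnS -mulnA mul2n odd_double (minn_idPl lt_yn).
Qed.

Opaque p_zeros.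

Lemma ltn_code_cons n s : n < CodeSeq.code (n :: s).
Proof. by case/andP: (CodeSeq.ltn_code (n :: s)). Qed.

Lemma peval_head v n s : v0 v = CodeSeq.code (n :: s) -> peval p_head v = n.
Proof.
move=> Ev; rewrite /p_head [LHS]/= (@peval_zeros _ n (CodeSeq.code s)) //=.
by rewrite Ev; apply/minn_idPr/ltnW/ltn_code_cons.
Qed.

Lemma peval_tail v s : v0 v = CodeSeq.code s ->
  peval p_tail v = CodeSeq.code (behead s).
Proof.
move=> Ev; rewrite /p_tail [LHS]/= peval_half /= peval_strip /= Ev.
case: s {Ev} => [//|n s].
rewrite [X in iter _ _ X]/= iter_strip.
have ->: n - CodeSeq.code (n :: s) = 0 by apply/eqP/ltnW/ltn_code_cons.
by rewrite mul1n /= uphalf_double.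
Qed.

Opaque p_head p_tail.

Lemma peval_drop v s : v1 v = CodeSeq.code s ->
  peval p_drop v = CodeSeq.code (drop (v0 v) s).
Proof.
move=> Ev; rewrite /=; elim: (v0 v) => [|y IH] /=; first by rewrite drop0.
by rewrite (@peval_tail _ (drop y s)) //= -drop1 drop_drop.
Qed.

Opaque p_drop.

Lemma code_eq0 s : (CodeSeq.code s == 0) = (s == [::]).
Proof. by case: s => // n s; rewrite /= muln_eq0 expn_eq0. Qed.

Lemma peval_count v s : v1 v = CodeSeq.code s ->
  peval p_count v = minn (v0 v) (size s).
Proof.
move=> Ev; rewrite /=; elim: (v0 v) => [|y IH]; first by rewrite min0n.
rewrite /= IH peval_add /= !peval_isz /= peval_isz /= (@peval_drop _ s) //=.
rewrite code_eq0 -size_eq0 size_drop subn_eq0.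
by case: (leqP (size s) y) => h /=;
  [rewrite (minn_idPr (leqW h)) | rewrite (minn_idPl h)].
Qed.

Opaque p_count.

Lemma size_code s : size s <= CodeSeq.code s.
Proof.
elim: s => //= n s IH; rewrite -addnn.
apply: (@leq_trans (2 ^ n * (size s).+1)); first by rewrite leq_pmull ?expn_gt0.
by rewrite leq_mul2l ltnS (leq_trans IH) ?leq_addr ?orbT.
Qed.

Lemma peval_len v s : v0 v = CodeSeq.code s -> peval p_len v = size s.
Proof.
move=> Ev; rewrite /p_len [LHS]/= (@peval_count _ s) //= Ev.
by apply/minn_idPr/size_code.
Qed.

Lemma peval_nth v s : v0 v = CodeSeq.code s -> v1 v < size s ->
  peval p_nth v = nth 0 s (v1 v).
Proof.
move=> Ev lt_is; rewrite /p_nth [LHS]/=.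
by apply: (@peval_head _ _ (drop (v1 v).+1 s)); rewrite /= (@peval_drop _ s) //= (drop_nth 0).
Qed.

Transparent p_isz p_pred p_sub p_if p_add p_odd p_half.
Transparent p_strip p_zeros p_head p_tail p_drop p_count.

(** * Application in Kleene's second model as a formula *)

Section Application.
Variable L : signature.
Implicit Types (s n l t : term L Num).

Local Notation x i := (Var Num i).
Local Notation up t := (tren (shift Num) t).

(* [p_sub] is truncated subtraction. *)
Definition Lt s t : form L := Equ (Prim p_sub (f2 (tSucc s) t)) (tZero L).

(* s is the code of the restriction of n^a to l. *)
Definition IsRestr s n (a : nat) l : form L :=
  And (Equ (Prim p_len (f1 s)) l)
 (And (Imp (Lt (tZero L) l) (Equ (Prim p_nth (f2 s (tZero L))) n))
      (All Num (Imp (Lt (tSucc (x 0)) (up l))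
                    (Equ (Prim p_nth (f2 (up s) (tSucc (x 0))))
                        (App (Var Fun a) (x 0)))))).

(* c(n^a restricted to l) = t *)
Definition ValAt (c : nat) n (a : nat) l t : form L :=
  Ex Num (And (IsRestr (x 0) (up n) a (up l))
              (Equ (App (Var Fun c) (x 0)) (up t))).

(* ca = b, for the function variables with these indices; in the body, n has
   index 1, l has index 0, and under the last quantifier l0 has index 0. *)
Definition Kapp (c a b : nat) : form L :=
  All Num (Ex Num (And
    (ValAt c (x 1) a (x 0) (tSucc (App (Var Fun b) (x 1))))
    (All Num (Imp (Lt (x 0) (x 1)) (ValAt c (x 2) a (x 0) (tZero L)))))).

(* Under the binders of alpha and beta, beta is the function variable 0 and
   alpha the function variable 1; on the right, gamma is the function variable
   2, so that the parameters of [A] are shifted past it. *)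
Definition Choice (A : form L) : form L :=
  Imp (Box (All Fun (Ex Fun (Box A))))
      (Ex Fun (Box (All Fun (Ex Fun
        (And (Kapp 2 1 0)
             (Box (fren (upren Fun (upren Fun (shift Fun))) A))))))).

End Application.

(* Main.v *)
From Stdlib Require List.
From mathcomp Require Import all_boot boolp classical_sets.
Require Import Defs.

Set Implicit Arguments.
Unset Strict Implicit.
Unset Printing Implicit Defensive.

Local Open Scope classical_set_scope.

(** Both halves are realizability arguments, so what has to be produced is
    elements of Kleene's second model that do not depend on the environment or
    on the set D.  A partial function whose values are determined by finite
    parts of its arguments is represented by an element ([represent]); applied
    to (a, b, c) |-> ac(bc) this gives the combinator s, and with s and k every
    applicative program has a bracket abstraction ([lamP]).  Realizers are
    therefore written as programs, and a program is checked pointwise, by typing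
    rules in which truth values are the types ([computes_lam], [computes_app]
    and the others); uniformity is automatic, a closed program having one value.

    Soundness.  For fixed D the operation X |-> (X => D) => D is a monad, and
    every value mu A r D is an algebra for it, by one realizer for all r and D
    ([stable]).  This yields classical logic: Kalmar's argument proves all the
    tautologies ([holds_tautology]).  Box intersects over all sets E and then
    applies the monad, which gives the S4 axioms and necessitation.  Induction
    needs a recursor; since a realizer of a number shows that number as its
    first value, any sequence of elements is enumerated by an element
    ([numcase]), so that the recursor is assembled from one realizer for each
    number ([induction_exists]).

    Choice.  A realizer f of the hypothesis sends each alpha to an element of
    the truth value at E of: some beta satisfies Box phi(alpha, beta), for every
    set E.  Taking for E the set of all pairs of a beta and a realizer of phi
    valid at all sets simultaneously, both occurrences of the monad collapse,
    and the double negation hands over such a pair ([extract_exists]).  So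
    alpha |-> beta is computed from f, and it is represented by some gamma.
    That gamma alpha = beta is then true, and the formula that says so is
    realized uniformly from gamma and alpha: its witnesses are the length at
    which gamma first answers and codes of restrictions of alpha
    ([Kapp_exists]). *)

(** * Representing continuous partial functions *)

Definition agree (l : nat) (a b : baire) : Prop := forall i, i < l -> a i = b i.

Lemma agree_le {l m a b} : l <= m -> agree m a b -> agree l a b.
Proof. by move=> le_lm ab i lt_il; apply/ab/(leq_trans lt_il). Qed.

Lemma agree_sym {l a b} : agree l a b -> agree l b a.
Proof. by move=> ab i /ab. Qed.

Lemma agree_trans {l a b c} : agree l a b -> agree l b c -> agree l a c.
Proof. by move=> ab bc i lt_il; rewrite ab ?bc. Qed.

Lemma restr_agree {l a b} : agree l a b -> restr a l = restr b l.
Proof.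
move=> ab; congr CodeSeq.code; apply/eq_in_map => i.
by rewrite mem_iota => /ab.
Qed.

Lemma restr_bcons_agree {l n a b} :
  agree l a b -> restr (bcons n a) l = restr (bcons n b) l.
Proof. by move=> ab; apply: restr_agree => -[|i] // /ltnW/ab. Qed.

(** The value at n depends on the finitely many values of the operator that are
    consulted, and on the part of the argument that occurs in those queries. *)
Lemma K2app_local {a b c} n : K2app a b c ->
  exists l, forall a' b' c', agree l a a' -> agree l b b' -> K2app a' b' c' ->
    c' n = c n.
Proof.
move=> /(_ n)[l [al al0]].
exists (maxn l (\max_(j < l.+1) (restr (bcons n b) j).+1)).
move=> a' b' c' aa' bb' /(_ n)[l' [al' al0']].
have aE j : j <= l -> a' (restr (bcons n b') j) = a (restr (bcons n b) j).
  move=> le_jl; rewrite -(restr_bcons_agree (a := b)) -?aa' //.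
    by rewrite leq_max (leq_bigmax (Ordinal (le_jl : j < l.+1))) orbT.
  by apply: agree_le bb'; rewrite leq_max le_jl.
have [lt_ll'|lt_l'l|eq_ll'] := ltngtP l l'.
- by move: (al0' _ lt_ll'); rewrite aE // al.
- by move: al'; rewrite aE ?al0 // ltnW.
- by move: al'; rewrite -eq_ll' aE // al => -[].
Qed.

Lemma K2app_local_upto m {a b c} : K2app a b c ->
  exists l, forall a' b' c', agree l a a' -> agree l b b' -> K2app a' b' c' ->
    agree m c c'.
Proof.
move=> abc; have /choice[l lP] := fun n => K2app_local n abc.
exists (\max_(n < m) l n) => a' b' c' aa' bb' abc' n lt_nm.
have le_l : l n <= \max_(n < m) l n by apply: (leq_bigmax (Ordinal lt_nm)).
by rewrite (lP n a' b' c') //; apply: agree_le le_l _.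
Qed.

Lemma K2app_fun {a b c c'} : K2app a b c -> K2app a b c' -> c = c'.
Proof.
by move=> abc abc'; apply: funext => n; have [l lP] := K2app_local n abc'; apply: lP abc.
Qed.

Definition locally_determined (F : baire -> baire -> baire -> baire -> Prop) :=
  forall a b c w n, F a b c w -> exists l, forall a' b' c' w',
    agree l a a' -> agree l b b' -> agree l c c' -> F a' b' c' w' -> w' n = w n.

(** The representing element waits, on a string t and finite parts of a and b of
    the same length, until all the values of F compatible with this information
    agree at n, and answers with their common value.  At the arguments
    in question an early answer is right, as they are compatible with what is
    known of them, and continuity makes it answer eventually. *)
Theorem represent F : locally_determined F ->
  exists e, forall a b, exists d, K2app2 e a b d /\
    forall c w, F a b c w -> K2app d c w.
Proof.
move=> Floc.
(* This holds of every m when nothing compatible lies in the domain of F; such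
   an answer does no harm. *)
pose forced a b t n m := forall a' b' c' w', agree (size t) a a' ->
  agree (size t) b b' -> agree (size t) (nth 0 t) c' -> F a' b' c' w' -> w' n = m.
pose G a b q := if CodeSeq.decode q is n :: t then
    if pselect (exists m, forced a b t n m) is left ex then (projT1 (cid ex)).+1
    else 0
  else 0.
have [a a' b b' q|e eP] := @rep2P (fun q => size (CodeSeq.decode q)) G.
  rewrite /G; case: (CodeSeq.decode q) => // n t aa' bb'.
  have /funext -> // : forced a b t n =1 forced a' b' t n.
  have {}aa' := agree_le (leqnSn (size t)) aa'.
  have {}bb' := agree_le (leqnSn (size t)) bb'.
  move=> m; apply/propext; split=> f x y c' w' ax bx; apply: f.
  - exact: agree_trans aa' ax.
  - exact: agree_trans bb' bx.
  - exact: agree_trans (agree_sym aa') ax.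
  - exact: agree_trans (agree_sym bb') bx.
exists e => a b; exists (G a b); split=> // c w abcw n.
have agree_c l : agree l (nth 0 (mkseq c l)) c by move=> i lt_il; rewrite nth_mkseq.
have forcedE l m : forced a b (mkseq c l) n m -> w n = m.
  by apply; rewrite ?size_mkseq //; apply: agree_c.
have GE l : G a b (restr (bcons n c) l.+1) =
    if pselect (exists m, forced a b (mkseq c l) n m) then (w n).+1 else 0.
  rewrite restrictS /G CodeSeq.codeK; case: pselect => // ex.
  by case: cid => m /= /forcedE ->.
have ex_l : exists l, G a b (restr (bcons n c) l) != 0.
  have [l lP] := Floc a b c w n abcw; exists l.+1.
  rewrite GE; case: pselect => // -[]; exists (w n) => a' b' c' w'.
  rewrite size_mkseq => aa' bb' /(agree_trans (agree_sym (agree_c l))).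
  exact: lP.
have G0 : G a b (restr (bcons n c) 0) = 0 by [].
have [[|l] Gl minl] := ex_minnP ex_l; first by rewrite G0 in Gl.
exists l.+1; split.
  by move: Gl; rewrite GE; case: pselect.
move=> l0 lt_l0; apply/eqP; apply: contraTT lt_l0 => /minl.
by rewrite -leqNgt.
Qed.

(** One direction of the defining equation is all that abstraction requires:
    sab must be defined, and sabc must be ac(bc) when the latter is defined. *)
Lemma s_combinator_exists : exists s, forall a b, exists sab, K2app2 s a b sab /\
  forall c u v w, K2app a c u -> K2app b c v -> K2app u v w -> K2app sab c w.
Proof.
pose F a b c w := exists u v, [/\ K2app a c u, K2app b c v & K2app u v w].
have [|s sP] := @represent F; last first.
  exists s => a b; have [sab [sabE sabP]] := sP a b; exists sab; split=> //.
  by move=> c u v w acu bcv uvw; apply: sabP; exists u, v.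
move=> a b c w n [u [v [acu bcv uvw]]].
have [l lP] := K2app_local n uvw.
have [l1 l1P] := K2app_local_upto l acu.
have [l2 l2P] := K2app_local_upto l bcv.
exists (maxn l1 l2) => a' b' c' w' aa' bb' cc' [u' [v' [acu' bcv' uvw']]].
by apply: (lP u' v') => //; [apply: l1P acu'|apply: l2P bcv'];
  apply: agree_le; try eassumption; rewrite leq_max leqnn ?orbT.
Qed.

(** * Programs and their typing by truth values *)

Local Notation "X ==> Y" := (tv_imp X Y).

(** Applicative terms with named variables and with elements of the model as
    constants. *)
Inductive prog := PVar (x : nat) | PCst (c : baire) | PApp (t u : prog).

Coercion PVar : nat >-> prog.
Coercion PCst : baire >-> prog.
Local Notation "t $ u" := (PApp t u) (at level 40, left associativity).

Fixpoint ev (rho : nat -> baire) (t : prog) (w : baire) : Prop :=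
  match t with
  | PVar x => w = rho x
  | PCst c => w = c
  | PApp t u => exists a b, [/\ ev rho t a, ev rho u b & K2app a b w]
  end.

Lemma ev_fun {rho t w w'} : ev rho t w -> ev rho t w' -> w = w'.
Proof.
elim: t w w' => [x|c|t IHt u IHu] w w' /=; [by move=> -> ->|by move=> -> ->|].
move=> [a [b [ta ub abw]]] [a' [b' [ta' ub' abw']]].
by rewrite (IHt _ _ ta' ta) (IHu _ _ ub' ub) in abw'; apply: K2app_fun abw abw'.
Qed.

Definition upd (rho : nat -> baire) (x : nat) (a : baire) : nat -> baire :=
  fun y => if y == x then a else rho y.

Definition computes rho t (X : set baire) : Prop := exists2 w, ev rho t w & X w.

Lemma computes_value {rho t w X} : ev rho t w -> computes rho t X -> X w.
Proof. by move=> tw [w' tw' Xw']; rewrite (ev_fun tw tw'). Qed.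

Lemma computes_var rho (x : nat) (X : set baire) : X (rho x) -> computes rho x X.
Proof. by move=> Xx; exists (rho x). Qed.

Lemma computes_cst rho (c : baire) (X : set baire) : X c -> computes rho c X.
Proof. by move=> Xc; exists c. Qed.

Lemma computes_app {rho t u X Y} :
  computes rho t (X ==> Y) -> computes rho u X -> computes rho (t $ u) Y.
Proof.
move=> [a ta aXY] [b ub Xb]; have [c abc Yc] := aXY b Xb.
by exists c => //; exists a, b.
Qed.

(** A program has a single value, so typings in a family of sets are all witnessed
    by the same element; the family must be inhabited for the value to exist. *)
Lemma computes_uniform {T : Type} rho t (x0 : T) (X : T -> set baire) :
  (forall x, computes rho t (X x)) -> exists2 w, ev rho t w & forall x, X x w.
Proof.
move=> tX; have [w tw _] := tX x0; exists w => // x.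
by apply: computes_value tw (tX x).
Qed.

Lemma computes_bigcap {T : Type} rho t (x0 : T) (X : T -> set baire) :
  (forall x, computes rho t (X x)) -> computes rho t (\bigcap_x X x).
Proof. by move=> /(computes_uniform x0)[w tw wX]; exists w => // x _. Qed.

Lemma computes_inst {T : Type} {rho t} (x : T) {X : T -> set baire} :
  computes rho t (\bigcap_y X y) -> computes rho t (X x).
Proof. by move=> [w tw Xw]; exists w => //; apply: Xw. Qed.

Lemma computes_bigcup {T : Type} {rho t} (x : T) {X : T -> set baire} :
  computes rho t (X x) -> computes rho t (\bigcup_y X y).
Proof. by move=> [w tw Xw]; exists w => //; exists x. Qed.

Definition dom0 (s : vsort) : dom s := if s is Fun then fun _ => 0 else 0.

Arguments computes_bigcup {T rho t} x {X}.
Arguments computes_inst {T rho t} x {X}.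

Section Realizers.
Variable C : combinators.

Definition cs : baire := projT1 (cid s_combinator_exists).

(** Bracket abstraction: the program, without the variable x, of the function
    x |-> t. *)
Fixpoint lam (x : nat) (t : prog) : prog :=
  match t with
  | PVar y => if y == x then cs $ ck C $ ck C else ck C $ y
  | PCst c => ck C $ c
  | PApp t u => cs $ lam x t $ lam x u
  end.

Arguments lam : simpl never.

Lemma lamP rho x t : exists2 f, ev rho (lam x t) f &
  forall a w, ev (upd rho x a) t w -> K2app f a w.
Proof.
have kE d : exists2 f, K2app (ck C) d f & forall a, K2app f a d.
  have [f [kf fE]] := ckE C d d; exists f => // a.
  by have [f' [kf' f'E]] := ckE C d a; rewrite (K2app_fun kf kf').
have csP := projT2 (cid s_combinator_exists).
elim: t => [y|c|t [f tf fP] u [g ug gP]]; rewrite /lam -/lam /=.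
- rewrite /upd; case: eqP => _.
    have [f kf fE] := kE (ck C); have [i [[si [csi sii]] iP]] := csP (ck C) (ck C).
    exists i; first by exists si, (ck C); split=> //; exists cs, (ck C).
    move=> a w ->; have [g kg gE] := kE a; exact: (iP a g g).
  by have [f kf fE] := kE (rho y); exists f => [|a w ->//]; exists (ck C), (rho y).
- by have [f kf fE] := kE c; exists f => [|a w ->//]; exists (ck C), c.
- have [sfg [[sf [csf sfE]] sfgP]] := csP f g; exists sfg.
    by exists sf, g; split=> //; exists cs, f.
  by move=> a w [u' [v' [tu uv uvw]]]; apply: sfgP uvw; [apply: fP|apply: gP].
Qed.

Lemma computes_lam rho x t (X Y : set baire) :
  (forall a, X a -> computes (upd rho x a) t Y) ->
  computes rho (lam x t) (X ==> Y).
Proof.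
move=> tY; have [f tf fP] := lamP rho x t; exists f => // a /tY[w tw Yw].
by exists w => //; apply: fP.
Qed.

Lemma computes_lam_bigcup {T : Type} rho x t (X : T -> set baire) (Y : set baire) :
  (forall i, computes rho (lam x t) (X i ==> Y)) ->
  computes rho (lam x t) ((\bigcup_i X i) ==> Y).
Proof.
move=> tXY; have [f tf _] := lamP rho x t; exists f => // a [i _ Xia].
exact: (computes_value tf (tXY i)) Xia.
Qed.

Lemma by_program x t (P : baire -> Prop) :
  (forall e rho, ev rho (lam x t) e -> P e) -> exists e, P e.
Proof. by move=> tP; have [e te _] := lamP (fun _ _ => 0) x t; exists e; apply: tP te. Qed.

Definition Pair t u := cp C $ t $ u.
Definition Fst t := cp0 C $ t.
Definition Snd t := cp1 C $ t.

Lemma K2app2_fun {e a b c c'} : K2app2 e a b c -> K2app2 e a b c' -> c = c'.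
Proof.
move=> [d [ead dbc]] [d' [ead' dbc']].
by rewrite (K2app_fun ead' ead) in dbc'; apply: K2app_fun dbc dbc'.
Qed.

Lemma computes_pair rho t u X Y : computes rho t X -> computes rho u Y ->
  computes rho (Pair t u) (tv_and C X Y).
Proof.
move=> [a ta Xa] [b ub Yb]; have [c [[d [pad dbc]] _ _]] := cpE C a b.
exists c; last by exists a, b; split=> //; exists d.
by exists d, b; split=> //; exists (cp C), a.
Qed.

Lemma computes_fst rho t X Y :
  computes rho t (tv_and C X Y) -> computes rho (Fst t) X.
Proof.
move=> [c tc [a [b [Xa Yb pabc]]]]; exists a => //; exists (cp0 C), c; split=> //.
by have [c' [pabc' p0E _]] := cpE C a b; rewrite (K2app2_fun pabc pabc').
Qed.

Lemma computes_snd rho t X Y :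
  computes rho t (tv_and C X Y) -> computes rho (Snd t) Y.
Proof.
move=> [c tc [a [b [Xa Yb pabc]]]]; exists b => //; exists (cp1 C), c; split=> //.
by have [c' [pabc' _ p1E]] := cpE C a b; rewrite (K2app2_fun pabc pabc').
Qed.

(** The injections are tagged by the two projection combinators, so the tag itself
    selects the branch. *)
Definition Inl t := Pair (ck C) t.
Definition Inr t := Pair (ckb C) t.
Definition Switch t f g := Fst t $ f $ g $ Snd t.

Lemma computes_inl rho t X Y : computes rho t X -> computes rho (Inl t) (tv_or C X Y).
Proof.
move=> tX; have ck_eq : computes rho (ck C) [set ck C] by apply: computes_cst.
have [c tc [_ [b [-> Xb pkb]]]] := computes_pair ck_eq tX.
by exists c => //; left; exists b.
Qed.

Lemma computes_inr rho t X Y : computes rho t Y -> computes rho (Inr t) (tv_or C X Y).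
Proof.
move=> tY; have ckb_eq : computes rho (ckb C) [set ckb C] by apply: computes_cst.
have [c tc [_ [b [-> Yb pkb]]]] := computes_pair ckb_eq tY.
by exists c => //; right; exists b.
Qed.

Lemma computes_switch rho t f g X Y Z : computes rho t (tv_or C X Y) ->
  computes rho f (X ==> Z) -> computes rho g (Y ==> Z) ->
  computes rho (Switch t f g) Z.
Proof.
move=> [c tc XYc] [a fa aXZ] [b gb bYZ].
have split_pair k X' : (exists2 x, X' x & K2app2 (cp C) k x c) ->
    computes rho (Fst t) [set k] /\ computes rho (Snd t) X'.
  move=> [x X'x pkx]; have tc' : computes rho t (tv_and C [set k] X').
    by exists c => //; exists k, x.
  by split; [apply: computes_fst tc'|apply: computes_snd tc'].
have select k w : computes rho (Fst t) [set k] -> K2app2 k a b w ->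
    computes rho (Fst t $ f $ g) [set w].
  move=> [k' tk k'E] [d [kad dbw]]; rewrite {}[k']k'E in tk; exists w => //.
  by exists d, b; split=> //; exists k, a.
case: XYc => /split_pair[t1 t2].
- have [w tw wE] := select _ _ t1 (ckE C a b); rewrite {}[w]wE in tw.
  by apply: computes_app t2; exists a.
- have [w tw wE] := select _ _ t1 (ckbE C a b); rewrite {}[w]wE in tw.
  by apply: computes_app t2; exists b.
Qed.

(** The two operations of the monad.  They are closed elements, so they can
    stand inside any abstraction without capturing its variables. *)
Lemma bind_exists : exists e, forall D X Y,
  (ominus D X ==> (X ==> ominus D Y) ==> ominus D Y) e.
Proof.
apply: (@by_program 0 (lam 1 (lam 2 (0 $ lam 3 (1 $ 3 $ 2))))) => e rho eE D X Y.
apply: (computes_value eE); apply: computes_lam => x xP; apply: computes_lam => f fP.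
apply: computes_lam => u uP; apply: (computes_app (X := X ==> D)).
  exact: computes_var.
apply: computes_lam => a Xa; apply: (computes_app (X := Y ==> D)).
  by apply: (computes_app (X := X)); apply: computes_var.
exact: computes_var.
Qed.

Lemma ret_exists : exists e, forall D X, (X ==> ominus D X) e.
Proof.
apply: (@by_program 0 (lam 1 (1 $ 0))) => e rho eE D X.
apply: (computes_value eE); apply: computes_lam => a Xa; apply: computes_lam => u uP.
by apply: (computes_app (X := X)); apply: computes_var.
Qed.

Definition cbind : baire := projT1 (cid bind_exists).
Definition cret : baire := projT1 (cid ret_exists).
Definition Bind t u := cbind $ t $ u.
Definition Ret t := cret $ t.

Lemma computes_bind rho t u D X Y : computes rho t (ominus D X) ->
  computes rho u (X ==> ominus D Y) -> computes rho (Bind t u) (ominus D Y).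
Proof.
move=> tX tY; apply: computes_app tY; apply: computes_app tX.
by apply: computes_cst; apply: (projT2 (cid bind_exists)).
Qed.

Lemma computes_ret rho t D X : computes rho t X -> computes rho (Ret t) (ominus D X).
Proof.
by apply: computes_app; apply: computes_cst; apply: (projT2 (cid ret_exists)).
Qed.

(** At D, absurdity yields D itself: every element, k for instance, maps the
    empty set into D. *)
Definition Abort t := t $ ck C.

Lemma computes_abort rho t D : computes rho t (ominus D set0) -> computes rho (Abort t) D.
Proof. by move=> t0; apply: computes_app t0 _; apply: computes_cst. Qed.

(** Follows the structure of a program, applying the typing rules.  A variable is
    looked up among the hypotheses, where an intersection may be instantiated;
    a constant is looked up in the same way; the index of a union is taken to be
    the last one introduced. *)
Ltac realize :=
  repeat lazymatch goal with
  | |- computes _ (lam _ _) (tv_imp (bigcup setT _) _) =>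
      apply: computes_lam_bigcup; intros ?
  | |- computes _ _ (bigcap setT (fun _ : set baire => _)) =>
      apply: (computes_bigcap set0); intros ?
  | |- computes _ _ (bigcap setT (fun _ : dom ?s => _)) =>
      apply: (computes_bigcap (dom0 s)); intros ?
  | |- computes _ (lam _ _) _ => apply: computes_lam; intros ? ?
  | |- computes _ (Pair _ _) (bigcup setT (fun _ : ?T => _)) =>
      match goal with x : T |- _ => apply: (computes_bigcup x) end
  | |- computes _ (Pair _ _) _ => apply: computes_pair
  | |- computes _ (Fst _) _ => apply: computes_fst
  | |- computes _ (Snd _) _ => apply: computes_snd
  | |- computes _ (Inl _) _ => apply: computes_inl
  | |- computes _ (Inr _) _ => apply: computes_inr
  | |- computes _ (Switch _ _ _) _ => apply: computes_switch
  | |- computes _ (Bind _ _) _ => apply: computes_bind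
  | |- computes _ (Ret _) _ => apply: computes_ret
  | |- computes _ (Abort _) _ => apply: computes_abort
  | |- computes _ (PApp _ _) _ => apply: computes_app
  | |- computes _ (PVar _) _ => apply: computes_var;
      first [eassumption | match goal with H : bigcap setT _ _ |- _ => exact: (H _ I) end]
  | |- computes _ (PCst _) _ => apply: computes_cst;
      first [by [] | solve [eauto] | match goal with H : _ |- _ => solve [apply: H] end]
  end.

(** A closed abstraction has a value, which is the same for all instances of the
    truth value to be realized; typing it at each instance is then enough. *)
Ltac program t :=
  let e := fresh "e" in let rho := fresh "rho" in let eE := fresh "eE" in
  match t with lam ?x ?u =>
    apply: (@by_program x u) => e rho eE; intros; apply: (computes_value eE);
    clear eE; cbn [Defs.mu Neg Iff] end.

(** * Uniform realizability and stability *)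

Section Soundness.
Context {L : signature} (N : expansion L).
Implicit Types (A B : form L) (r : env) (D : set baire).
Local Notation mu := (mu C N).

Let r0 : env := fun s _ => dom0 s.

(** Validity asks for an element sending everything into the truth values; an
    element of all of them amounts to the same and is easier to handle. *)
Definition holds A : Prop := exists e, forall r D, mu A r D e.

Lemma holds_valid A : holds A <-> valid C N A.
Proof.
split=> [[w wA]|[e eA]].
  have [e] : exists e, forall X, X w -> (setT ==> X) e.
    by program (lam 0 w); realize.
  by move=> eX; exists e => r D; apply: eX.
have [|w _ wA] := @computes_uniform (env * set baire) (fun _ => e) (e $ e)
    (r0, set0) (fun i => mu A i.1 i.2); last by exists w => r D; apply: (wA (r, D)).
by move=> [r D]; apply: (computes_app (X := setT)); apply: computes_cst => //; apply: eA.
Qed.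

Lemma holds_mp {A B} : holds (Imp A B) -> holds A -> holds B.
Proof.
move=> [f fAB] [a aA].
have [|w _ wB] := @computes_uniform (env * set baire) (fun _ => f) (f $ a)
    (r0, set0) (fun i => mu B i.1 i.2); last by exists w => r D; apply: (wB (r, D)).
move=> [r D]; apply: (computes_app (X := mu A r D)); apply: computes_cst => //.
exact: fAB.
Qed.

(** Atoms, disjunctions, existentials and boxes are in the image of the monad,
    and algebras are closed under products and exponentials. *)
Lemma stable A : exists e, forall r D, (ominus D (mu A r D) ==> mu A r D) e.
Proof.
have [join joinP] : exists e, forall D X, (ominus D (ominus D X) ==> ominus D X) e.
  by program (lam 0 (Bind 0 (lam 1 1))); realize.
elim: A => //=.
- by exists join.
- by exists join.
- by exists join.
- move=> A [a aA] B [b bB].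
  program (lam 0 (Pair (a $ lam 1 (0 $ lam 2 (1 $ Fst 2)))
                       (b $ lam 1 (0 $ lam 2 (1 $ Snd 2))))).
  by realize.
- by exists join.
- move=> A [a aA] B [b bB].
  by program (lam 0 (lam 1 (b $ lam 2 (0 $ lam 3 (2 $ (3 $ 1)))))); realize.
- move=> s A [a aA].
  program (lam 0 (lam 1 (a $ lam 2 (0 $ lam 3 (2 $ (3 $ 1)))))).
  by realize.
- by move=> s A _; exists join.
- by move=> A _; exists join.
Qed.

(** * Classical tautologies *)

Lemma holds_and A B : holds (Imp A (Imp B (And A B))).
Proof. by program (lam 0 (lam 1 (Pair 0 1))); realize. Qed.

Lemma holds_nandl A B : holds (Imp (Neg A) (Neg (And A B))).
Proof. by program (lam 0 (lam 1 (0 $ Fst 1))); realize. Qed.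

Lemma holds_nandr A B : holds (Imp (Neg B) (Neg (And A B))).
Proof. by program (lam 0 (lam 1 (0 $ Snd 1))); realize. Qed.

Lemma holds_orl A B : holds (Imp A (Or A B)).
Proof. by program (lam 0 (Ret (Inl 0))); realize. Qed.

Lemma holds_orr A B : holds (Imp B (Or A B)).
Proof. by program (lam 0 (Ret (Inr 0))); realize. Qed.

Lemma holds_nor A B : holds (Imp (Neg A) (Imp (Neg B) (Neg (Or A B)))).
Proof. by program (lam 0 (lam 1 (lam 2 (Bind 2 (lam 3 (Switch 3 0 1)))))); realize. Qed.

Lemma holds_impr A B : holds (Imp B (Imp A B)).
Proof. by program (lam 0 (lam 1 0)); realize. Qed.

Lemma holds_impl A B : holds (Imp (Neg A) (Imp A B)).
Proof.
have [b bB] := stable B.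
by program (lam 0 (lam 1 (b $ lam 2 (Abort (0 $ 1))))); realize.
Qed.

Lemma holds_nimp A B : holds (Imp A (Imp (Neg B) (Neg (Imp A B)))).
Proof. by program (lam 0 (lam 1 (lam 2 (1 $ (2 $ 0))))); realize. Qed.

Lemma holds_id A : holds (Imp A A).
Proof. by program (lam 0 0); realize. Qed.

Lemma holds_trans {A B} H : holds (Imp A B) -> holds (Imp H A) -> holds (Imp H B).
Proof.
by move=> [f fAB] [a aA]; program (lam 0 (f $ (a $ 0))); realize.
Qed.

Lemma holds_trans2 {A B A'} H : holds (Imp A (Imp B A')) -> holds (Imp H A) ->
  holds (Imp H B) -> holds (Imp H A').
Proof.
by move=> [f fABD] [a aA] [b bB]; program (lam 0 (f $ (a $ 0) $ (b $ 0))); realize.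
Qed.

(** Excluded middle for A, in the only form that is used: B is stable, so a
    refutation of B may be assumed, and it refutes A. *)
Lemma holds_cases H A B : holds (Imp (And H A) B) -> holds (Imp (And H (Neg A)) B) ->
  holds (Imp H B).
Proof.
have [b bB] := stable B => -[f fAB] [g gAB].
program (lam 0 (b $ lam 1 (1 $ (g $ Pair 0 (lam 2 (lam 3 (1 $ (f $ Pair 0 2)))))))).
by realize.
Qed.

(** The subformulas to which a propositional valuation assigns its values. *)
Fixpoint primes A : seq (form L) :=
  match A with
  | Bot => [::]
  | And A B | Or A B | Imp A B => primes A ++ primes B
  | _ => [:: A]
  end.

Definition literal (v : form L -> bool) A : form L :=
  if v A then A else Neg A.

(** Kalmar's lemma: the truth table of A is derivable line by line. *)
Lemma kalmar H v A :
  (forall P, List.In P (primes A) -> holds (Imp H (literal v P))) ->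
  holds (Imp H (if bool_eval v A then A else Neg A)).
Proof.
have prime P : (forall P', List.In P' [:: P] -> holds (Imp H (literal v P'))) ->
    holds (Imp H (if v P then P else Neg P)).
  by apply; left.
elim: A => //=.
- by move=> _; apply: (@holds_mp (Neg Bot)); [apply: holds_impr|apply: holds_id].
- by move=> s t u; apply: prime.
- by move=> R ts; apply: prime.
- move=> A IHA B IHB lits.
  have {}IHA := IHA (fun P inP => lits P (List.in_or_app _ _ _ (or_introl inP))).
  have {}IHB := IHB (fun P inP => lits P (List.in_or_app _ _ _ (or_intror inP))).
  move: IHA IHB; case: (bool_eval v A) => /= HA; last first.
    by move=> _; apply: holds_trans HA; apply: holds_nandl.
  case: (bool_eval v B) => HB; first by apply: holds_trans2 HA HB; apply: holds_and.
  by apply: holds_trans HB; apply: holds_nandr.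
- move=> A IHA B IHB lits.
  have {}IHA := IHA (fun P inP => lits P (List.in_or_app _ _ _ (or_introl inP))).
  have {}IHB := IHB (fun P inP => lits P (List.in_or_app _ _ _ (or_intror inP))).
  move: IHA IHB; case: (bool_eval v A) => /= HA.
    by move=> _; apply: holds_trans HA; apply: holds_orl.
  case: (bool_eval v B) => HB; last by apply: holds_trans2 HA HB; apply: holds_nor.
  by apply: holds_trans HB; apply: holds_orr.
- move=> A IHA B IHB lits.
  have {}IHA := IHA (fun P inP => lits P (List.in_or_app _ _ _ (or_introl inP))).
  have {}IHB := IHB (fun P inP => lits P (List.in_or_app _ _ _ (or_intror inP))).
  move: IHA IHB; case: (bool_eval v A) => /= HA; last first.
    by move=> _; apply: holds_trans HA; apply: holds_impl.
  case: (bool_eval v B) => HB; last by apply: holds_trans2 HA HB; apply: holds_nimp.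
  by apply: holds_trans HB; apply: holds_impr.
- by move=> s A _; apply: prime.
- by move=> s A _; apply: prime.
- by move=> A _; apply: prime.
Qed.

(** The prime formulas are discharged one at a time, by cases on each. *)
Lemma holds_tautology A : tautology A -> holds A.
Proof.
move=> tautA.
suff elim_primes ps : forall H v, (forall P, List.In P (primes A) ->
    List.In P ps \/ holds (Imp H (literal v P))) -> holds (Imp H A).
  apply: (@holds_mp (Imp Bot Bot)); last exact: holds_id.
  by apply: (elim_primes (primes A) _ (fun _ => true)) => P; left.
(* The prime formulas that are not in ps are already decided by H, as v says. *)
elim: ps => [|P ps IH] H v lits.
  by have := @kalmar H v A; rewrite tautA; apply => P /lits[].
have weaken B B' : holds (Imp H B) -> holds (Imp (And H B') B).
  by move=> [h hP]; program (lam 0 (h $ Fst 0)); realize.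
have extend b : holds (Imp (And H (if b then P else Neg P)) A).
  apply: (IH _ (fun P' => if `[< P' = P >] then b else v P')) => P' /lits.
  rewrite /literal; case: asboolP => [-> _|neP [[/esym//|]|]].
  - by right; program (lam 0 (Snd 0)); realize.
  - by left.
  - by right; apply: weaken.
exact: holds_cases (extend true) (extend false).
Qed.

(** * Renaming and substitution in truth values *)

Lemma env_ext (r r' : env) : (forall s i, r s i = r' s i) -> r = r'.
Proof.
by move=> rr'; apply: functional_extensionality_dep => s; apply: funext => i.
Qed.

Lemma teval_ren (x : ren) s (t : term L s) r :
  teval N r (tren x t) = teval N (fun s i => r s (x s i)) t.
Proof.
elim: t => //= [a IHa t IHt|n f ts IH|f ts IH]; first by rewrite IHa IHt.
- by congr peval; apply: funext.
- by congr fint; apply: funext.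
Qed.

Lemma teval_subst (f : subst L) s (t : term L s) r :
  teval N r (tsubst f t) = teval N (fun s i => teval N r (f s i)) t.
Proof.
elim: t => //= [a IHa t IHt|n g ts IH|g ts IH]; first by rewrite IHa IHt.
- by congr peval; apply: funext.
- by congr fint; apply: funext.
Qed.

Lemma scons_zero s (c : dom s) r : scons c r s 0 = c.
Proof. by case: s c. Qed.

Lemma scons_shift s (c : dom s) r s' i : scons c r s' (shift s s' i) = r s' i.
Proof. by case: s c; case: s' i. Qed.

Lemma teval_shift s s' (c : dom s) r (t : term L s') :
  teval N (scons c r) (tren (shift s) t) = teval N r t.
Proof.
by rewrite teval_ren; congr (teval N _ t); apply: env_ext => *; apply: scons_shift.
Qed.

Lemma mu_ren A (x : ren) r D : mu (fren x A) r D = mu A (fun s i => r s (x s i)) D.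
Proof.
have up s (c : dom s) x' r' : (fun s' i => scons c r' s' (upren s x' s' i)) =
    scons c (fun s' i => r' s' (x' s' i)).
  by apply: env_ext => s' i; case: s c; case: s' i => [[|i]|[|i]] c //=.
elim: A x r D => //=.
- by move=> s t u x r D; rewrite !teval_ren.
- move=> R ts x r D; congr (ominus D (rint _ _)).
  by apply: functional_extensionality_dep => i; rewrite teval_ren.
- by move=> A IHA B IHB x r D; rewrite IHA IHB.
- by move=> A IHA B IHB x r D; rewrite IHA IHB.
- by move=> A IHA B IHB x r D; rewrite IHA IHB.
- move=> s A IH x r D; apply: eq_bigcapr => c _; by rewrite IH up.
- move=> s A IH x r D; congr ominus; apply: eq_bigcupr => c _; by rewrite IH up.
- move=> A IH x r D; congr ominus; apply: eq_bigcapr => c _; by rewrite IH.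
Qed.

Lemma mu_subst A (f : subst L) r D :
  mu (fsubst f A) r D = mu A (fun s i => teval N r (f s i)) D.
Proof.
have up s (c : dom s) f' r' :
    (fun s' i => teval N (scons c r') (upsubst s f' s' i)) =
    scons c (fun s' i => teval N r' (f' s' i)).
  apply: env_ext => s' i; rewrite /upsubst.
  by move: (@teval_shift s s' c r'); case: s c; case: s' i => [[|i]|[|i]] c //=.
elim: A f r D => //=.
- by move=> s t u f r D; rewrite !teval_subst.
- move=> R ts f r D; congr (ominus D (rint _ _)).
  by apply: functional_extensionality_dep => i; rewrite teval_subst.
- by move=> A IHA B IHB f r D; rewrite IHA IHB.
- by move=> A IHA B IHB f r D; rewrite IHA IHB.
- by move=> A IHA B IHB f r D; rewrite IHA IHB.
- move=> s A IH f r D; apply: eq_bigcapr => c _; by rewrite IH up.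
- move=> s A IH f r D; congr ominus; apply: eq_bigcupr => c _; by rewrite IH up.
- move=> A IH f r D; congr ominus; apply: eq_bigcapr => c _; by rewrite IH.
Qed.

Lemma mu_inst s A (t : term L s) r D : mu (inst A t) r D = mu A (scons (teval N r t) r) D.
Proof.
by rewrite mu_subst; congr mu; apply: env_ext => s' i; case: s t; case: s' i => [[|i]|[|i]].
Qed.

Lemma mu_shift s A (c : dom s) r D : mu (fren (shift s) A) (scons c r) D = mu A r D.
Proof. by rewrite mu_ren; congr mu; apply: env_ext => *; apply: scons_shift. Qed.

(** * Soundness of epistemic arithmetic *)

Lemma holds_iff A B : holds (Imp A B) -> holds (Imp B A) -> holds (Iff A B).
Proof. by move=> AB; apply: holds_mp; apply: holds_mp AB; apply: holds_and. Qed.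

Lemma holds_equ s (t u : term L s) : (forall r, teval N r t = teval N r u) ->
  holds (Equ t u).
Proof.
move=> tu; program (lam 0 (0 $ ck C)); rewrite tu; apply: computes_lam => a Xa.
by apply: computes_app; [apply: computes_var; apply: Xa|apply: computes_cst].
Qed.

Lemma holds_equ_imp s s' (t u : term L s) (t' u' : term L s') :
  (forall r, teval N r t = teval N r u -> teval N r t' = teval N r u') ->
  holds (Imp (Equ t u) (Equ t' u')).
Proof.
move=> tu; program (lam 0 (Bind 0 (lam 1 (Ret (ck C))))).
by realize; apply: computes_cst; apply: tu.
Qed.

Definition num (n : nat) : baire := fun _ => n.

(** A realizer q of a number shows it as q 0, so G can be consulted there: every
    sequence of elements, computable or not, is enumerated by one element. *)
Definition numcase (G : nat -> baire) : baire := rep1 (fun _ => 1) (fun q => G (q 0)).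

Lemma numcaseP (X : nat -> set baire) G : (forall n, X n (G n)) ->
  forall n, (@Q Num n ==> X n) (numcase G).
Proof.
move=> XG n q qn; exists (G (q 0)); last by move: qn => /= ->.
by apply: rep1P => a b m /(_ 0) ->.
Qed.

(** For each numeral n the step is iterated n times; these realizers, one for
    every n, are then enumerated by a single element. *)
Lemma induction_exists : exists e, forall X : nat -> set baire,
  (X 0 ==> (\bigcap_(n : dom Num) (Q n ==> (X n ==> X n.+1)) ==>
    \bigcap_(n : dom Num) (Q n ==> X n))) e.
Proof.
have /choice[G GP] n : exists e, forall X : nat -> set baire,
    (X 0 ==> (\bigcap_(n : dom Num) (Q n ==> (X n ==> X n.+1)) ==> X n)) e.
  elim: n => [|n [e eP]]; first by program (lam 0 (lam 1 0)); realize.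
  program (lam 0 (lam 1 (1 $ num n $ (e $ 0 $ 1)))).
  by realize.
have caseP X n := @numcaseP (fun n => _) G (fun n => GP n X) n.
program (lam 0 (lam 1 (lam 2 (numcase G $ 2 $ 0 $ 1)))); realize.
Qed.

(** The two forms Z and Z' of the same family let the permuted formula be used
    without rewriting under its quantifiers. *)
Lemma exchange_exists s s' : exists e, forall Z Z'
  (ZZ' : forall (c : dom s) (c' : dom s'), Z c c' = Z' c' c),
  (\bigcap_c (Q c ==> \bigcap_c' (Q c' ==> Z c c')) ==>
   \bigcap_c' (Q c' ==> \bigcap_c (Q c ==> Z' c' c))) e.
Proof.
program (lam 0 (lam 1 (lam 2 (0 $ 2 $ 1)))).
apply: computes_lam => f fP; apply: (computes_bigcap (dom0 s')) => c'.
apply: computes_lam => b c'b; apply: (computes_bigcap (dom0 s)) => c.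
apply: computes_lam => a ca; apply: (computes_app (X := Q c')); last exact: computes_var.
apply: (computes_inst c' (X := fun c' => Q c' ==> Z' c' c)).
under eq_bigcapr => d _ do rewrite -ZZ'.
by apply: (computes_app (X := Q c)); apply: computes_var => //; apply: fP.
Qed.

Theorem holds_EA A : EA A -> holds A.
Proof.
have Q0 s : Q (dom0 s) (num 0) by case: s.
elim=> {A}.
- exact: holds_tautology.
- move=> A B; program (lam 0 (lam 1 (Bind 0 (lam 2 (Bind 1 (lam 3 (Ret (2 $ 3)))))))).
  by realize.
- move=> A; have [a aA] := stable A.
  by program (lam 0 (a $ Bind 0 (lam 1 (Ret 1)))); realize.
- by move=> A; program (lam 0 (Bind 0 (lam 1 (Ret (Ret 1))))); realize.
- move=> s A; apply: holds_iff.
    program (lam 0 (0 $ num 0)); apply: computes_lam => f fP.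
    rewrite -(mu_shift A (dom0 s)); apply: computes_app (computes_cst _ (Q0 s)).
    exact/computes_var/fP.
  by program (lam 0 (lam 1 0)); realize; rewrite mu_shift; realize.
- by move=> s A B; program (lam 0 (lam 1 (lam 2 (0 $ 2 $ (1 $ 2))))); realize.
- move=> s s' A.
  have swap r D (c : dom s) (c' : dom s') : mu A (scons c' (scons c r)) D =
      mu (fsubst (scons (Var s' (shift s s' 0)) (scons (Var s 0)
           (fun u i => Var u (shift s u (shift s' u i))))) A) (scons c (scons c' r)) D.
    rewrite mu_subst; congr mu; apply: env_ext => u i.
    by case: s' s u c c' => [] [] [] c c'; case: i => [|[|i]].
  have [e eP] := exchange_exists s s'; have [e' e'P] := exchange_exists s' s.
  apply: holds_iff.
    by exists e => r D; apply: eP => c c'; apply: swap.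
  by exists e' => r D; apply: e'P => c c'; apply/esym/swap.
- move=> s A; program (lam 0 (lam 1 (1 $ 0))); realize.
  by rewrite mu_inst /= scons_zero; realize.
- move=> s A; apply: holds_iff.
    by program (lam 0 (lam 1 (Bind 0 (lam 2 (1 $ Fst 2 $ Snd 2))))); realize.
  program (lam 0 (lam 1 (Abort (0 $ lam 2 (lam 3 (lam 4 (1 $ Pair 2 3))))))).
  by realize.
- by move=> s t; apply: holds_equ.
- move=> s t u A; have [a aA] := stable (inst A u).
  program (lam 0 (lam 1 (a $ lam 2 (0 $ lam 3 (2 $ 1))))); realize.
  apply: computes_var; rewrite mu_inst.
  match goal with H : mu _ r D _, e : [set _ | _ = _] _ |- _ =>
    by rewrite e -mu_inst end.
- by move=> t; program (lam 0 (Bind 0 (lam 1 1))); realize.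
- by move=> t u; apply: holds_equ_imp => r [].
- by move=> n i ts; apply: holds_equ.
- by move=> m n g h ts; apply: holds_equ.
- by move=> n g h ts; apply: holds_equ => r /=; congr peval; apply: funext => -[].
- move=> n g h t ts; apply: holds_equ => r /=.
  have tail (u : term L Num) :
      (fun i => teval N r (fcons u ts (onext i))) = fun i => teval N r (ts i).
    by apply: funext => -[].
  by congr peval; apply: funext => -[[|[|i]]] //= _; rewrite !tail.
- move=> A; have [e eP] := induction_exists.
  program (lam 0 (e $ Fst 0 $ Snd 0)).
  apply: computes_lam => a; rewrite mu_inst => aP.
  pose X n := mu A (@scons dom Num n r) D.
  have step : computes (upd rho 0 a) 0
      (tv_and C (X 0) (\bigcap_n (@Q Num n ==> (X n ==> X n.+1)))).
    apply/computes_var; move: aP; congr (tv_and _ _ _ _); apply: eq_bigcapr => n _.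
    congr (_ ==> (_ ==> _)); rewrite mu_subst; congr mu.
    by apply: env_ext => -[] // [].
  apply: computes_app; last exact: computes_snd step.
  apply: computes_app; last exact: computes_fst step.
  by apply: computes_cst; apply: (eP X).
- by move=> A B _ AB _ HA; apply: holds_mp AB HA.
- by move=> s A _ [a aA]; program (lam 0 a); realize.
- by move=> A _ [a aA]; program (lam 0 (0 $ a)); realize.
Qed.

(** * Realizing the graph of application *)

Lemma computes_equ rho s (t u : term L s) r D :
  teval N r t = teval N r u -> computes rho (Ret (ck C)) (mu (Equ t u) r D).
Proof. by move=> tu; apply: computes_ret; apply: computes_cst. Qed.

Lemma mu_Lt (t u : term L Num) r D :
  mu (Lt t u) r D = ominus D [set _ | teval N r t < teval N r u].
Proof.
have subE : teval N r (Prim p_sub (f2 (tSucc t) u)) = (teval N r t).+1 - teval N r u.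
  exact: peval_sub.
have ltE : teval N r (Prim p_sub (f2 (tSucc t) u)) = 0 <-> teval N r t < teval N r u.
  by rewrite subE; split=> /eqP.
by congr (ominus D _); apply: funext => a; apply: propext ltE.
Qed.

(** A true comparison has no content, so the bound hypothesis is ignored; a false
    one gives a realizer in the monad applied to the empty set, and binding it
    reaches any value of the monad. *)
Lemma computes_if_Lt rho x y p (t u : term L Num) B r D X :
  mu B r D = ominus D X ->
  (teval N r t < teval N r u ->
    forall a b, computes (upd (upd rho x a) y b) p (mu B r D)) ->
  computes rho (lam x (Bind x (lam y p))) (mu (Lt t u) r D ==> mu B r D).
Proof.
move=> BE tu; rewrite BE mu_Lt in tu *; apply: computes_lam => a aP.
apply: computes_bind; first by apply: computes_var; rewrite /upd eqxx; apply: aP.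
by apply: computes_lam => b bP; apply: tu.
Qed.

Definition equ_if_lt := lam 0 (Bind 0 (lam 1 (Ret (ck C)))).

Lemma computes_equ_if_lt rho s (t u : term L Num) (t' u' : term L s) r D :
  (teval N r t < teval N r u -> teval N r t' = teval N r u') ->
  computes rho equ_if_lt (mu (Lt t u) r D ==> mu (Equ t' u') r D).
Proof.
by move=> tu; apply: computes_if_Lt => // /tu E *; apply: computes_equ.
Qed.

(** All the clauses that characterize a restriction are equations, so when they
    are true a fixed program realizes them. *)
Definition restr_facts :=
  Pair (Ret (ck C)) (Pair equ_if_lt (lam 0 equ_if_lt)).

Lemma computes_IsRestr rho (s n l : term L Num) a r D :
  teval N r s = restr (bcons (teval N r n) (r Fun a)) (teval N r l) ->
  computes rho restr_facts (mu (IsRestr s n a l) r D).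
Proof.
move=> sE; rewrite /IsRestr; cbn [Defs.mu]; apply: computes_pair; last apply: computes_pair.
- apply: computes_equ.
  transitivity (size (mkseq (bcons (teval N r n) (r Fun a)) (teval N r l))).
    by apply: peval_len.
  by rewrite size_mkseq.
- apply: computes_equ_if_lt => lt_l.
  apply: etrans (_ : nth 0 (mkseq (bcons (teval N r n) (r Fun a)) (teval N r l)) 0 = _).
    by apply: peval_nth => //=; rewrite size_mkseq.
  by rewrite nth_mkseq.
- apply: (computes_bigcap 0) => m; apply: computes_lam => b _.
  apply: computes_equ_if_lt; rewrite teval_shift => lt_l.
  apply: etrans (_ : nth 0 (mkseq (bcons (teval N r n) (r Fun a)) (teval N r l)) m.+1 = _).
    apply: peval_nth; last by rewrite size_mkseq.
    by apply: etrans sE; apply: teval_shift.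
  by rewrite nth_mkseq.
Qed.

Definition val_at t := Ret (Pair t (Pair restr_facts (Ret (ck C)))).

Lemma computes_ValAt rho p c (n l t : term L Num) a r D :
  let q := restr (bcons (teval N r n) (r Fun a)) (teval N r l) in
  computes rho p (@Q Num q) -> r Fun c q = teval N r t ->
  computes rho (val_at p) (mu (ValAt c n a l t) r D).
Proof.
move=> q pq cq; apply: computes_ret; apply: (computes_bigcup (q : dom Num)).
apply: computes_pair pq (computes_pair _ _).
  by apply: computes_IsRestr; rewrite !teval_shift.
by apply: computes_equ; rewrite teval_shift.
Qed.

(** Replacing each answer of g by the length of the string that it answers, the
    unbounded search for this length is done by application itself. *)
Lemma lengths_exist : exists e, forall g a b, K2app g a b -> exists2 l : nat -> nat,
  (([set g] ==> ([set a] ==> [set l])) e) &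
  forall n, g (restr (bcons n a) (l n)) = (b n).+1 /\
    forall l0, l0 < l n -> g (restr (bcons n a) l0) = 0.
Proof.
pose G g q := if g q is 0 then 0 else (size (CodeSeq.decode q)).+1.
exists (rep1 S G) => g a b /choice[l lP]; exists l => // _ ->.
exists (G g); first by apply: rep1P => x y m xy; rewrite /G xy.
move=> _ ->; exists l => // n; exists (l n); have [gl gl0] := lP n; split.
  by rewrite /G gl /restr CodeSeq.codeK size_mkseq.
by move=> l0 /gl0; rewrite /G => ->.
Qed.

Lemma value_exists : exists e, forall (n : nat) (l : baire),
  (@Q Num n ==> ([set l] ==> @Q Num (l n))) e.
Proof.
exists (numcase (fun n => rep1 (fun _ => n.+1) (fun l _ => l n))) => n l.
apply: (@numcaseP (fun n => [set l] ==> @Q Num (l n))) => {}n _ ->.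
exists (fun _ => l n) => //.
by apply: (@rep1P (fun _ => n.+1) (fun l _ => l n)) => a b m; apply.
Qed.

Lemma restr_exists : exists e, forall (n l : nat) (a : baire),
  (@Q Num n ==> (@Q Num l ==> ([set a] ==>
    @Q Num (restr (bcons n a) l)))) e.
Proof.
pose G n l := rep1 (fun _ => l) (fun a _ => restr (bcons n a) l).
exists (numcase (fun n => numcase (G n))) => n l a.
apply: (@numcaseP (fun n => _ ==> ([set a] ==> @Q Num (restr (bcons n a) l)))) => {}n.
apply: (@numcaseP (fun l => [set a] ==> @Q Num (restr (bcons n a) l))) => {}l _ ->.
exists (fun _ => restr (bcons n a) l) => //.
apply: (@rep1P (fun _ => l) (fun a _ => restr (bcons n a) l)) => x y _.
by move=> /restr_bcons_agree.
Qed.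

Lemma Kapp_exists : exists e, forall c a b r D
  (cab : K2app (r Fun c) (r Fun a) (r Fun b)),
  ([set r Fun c] ==> ([set r Fun a] ==> mu (Kapp L c a b) r D)) e.
Proof.
have [len lenP] := lengths_exist; have [val valP] := value_exists.
have [str strP] := restr_exists.
(* Variables 0, 1, 2, 3 hold gamma, alpha, the number n and the number l0. *)
pose l := val $ 2 $ (len $ 0 $ 1).
program (lam 0 (lam 1 (lam 2 (Ret (Pair l (Pair (val_at (str $ 2 $ l $ 1))
  (lam 3 (lam 4 (Bind 4 (lam 5 (val_at (str $ 2 $ 3 $ 1)))))))))))).
have [ln lnP lnE] := lenP _ _ _ cab; rewrite /Kapp; cbn [Defs.mu].
apply: computes_lam => g gE; apply: computes_lam => a' aE.
apply: (computes_bigcap 0) => n; apply: computes_lam => q qn; apply: computes_ret.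
set rho' := upd _ 2 q.
have lE : computes rho' l (@Q Num (ln n)) by rewrite /l; realize.
apply: (computes_bigcup (ln n : dom Num)); apply: (computes_pair lE).
have strE m p s : computes s p (@Q Num m) -> s 1 = a' -> s 2 = q ->
    computes s (str $ 2 $ p $ 1) (@Q Num (restr (bcons n (r Fun a)) m)).
  move=> pm s1 s2; apply: computes_app; last by apply: computes_var; rewrite s1; apply: aE.
  apply: computes_app pm; apply: computes_app; last first.
    by apply: computes_var; rewrite s2; apply: qn.
  by apply: computes_cst; apply: strP.
apply: computes_pair.
  by apply: computes_ValAt; [apply: strE|apply: (lnE n).1].
apply: (computes_bigcap 0) => m; apply: computes_lam => q' q'm.
apply: computes_if_Lt => // lt_m d d'; apply: computes_ValAt.
  by apply: strE; first by apply: computes_var; apply: q'm.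
by have [_] := lnE n; apply.
Qed.

(** * The choice schema *)

(** With E the set of the witnesses themselves, a proof at E that witnesses exist
    can be run with the identity as its continuation. *)
Lemma extract_exists : exists e, forall (T : Type) (P X : T -> set baire) E
  (EE : E = \bigcup_b tv_and C (P b) (X b)),
  (ominus E (\bigcup_b tv_and C (P b) (ominus E (X b))) ==> E) e.
Proof.
program (lam 0 (0 $ lam 1 (Snd 1 $ lam 2 (Pair (Fst 1) 2)))); realize.
by rewrite EE; realize.
Qed.

(** The value of gamma alpha is the first component of what is extracted from the
    hypothesis at alpha, and the realizer of Box phi(alpha, beta) is the second. *)
Theorem holds_Choice A : holds (Choice A).
Proof.
have [ext extP] := extract_exists; have [kapp kappP] := Kapp_exists.
(* Variables 1, 2, 3 hold the realizer of the hypothesis, alpha and gamma. *)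
pose select := ext $ (1 $ 2).
pose result := lam 2 (Ret (Pair (Fst select) (Pair (kapp $ 3 $ 2) (Ret (Snd select))))).
program (lam 0 (Bind 0 (lam 1 (lam 3 (Ret (Pair 3 (Ret result))) $ lam 2 (Fst select))))).
rewrite /Choice; cbn [Defs.mu].
apply: computes_lam => h hP; apply: computes_bind; first by apply: computes_var; apply: hP.
apply: computes_lam => f fP.
pose X a b := \bigcap_F mu A (@scons dom Fun b (@scons dom Fun a r)) F.
have selectE s a : s 1 = f -> s 2 = a ->
    computes s select (\bigcup_b tv_and C [set b] (X a b)).
  move=> s1 s2; pose E := \bigcup_b tv_and C [set b] (X a b).
  apply: computes_app; first by apply: computes_cst; apply: (extP _ _ (X a) E).
  apply: (computes_app (X := [set a])); apply: computes_var; last by rewrite s2.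
  by rewrite s1; apply: (fP E I a I).
(* The element selected depends only on the values of the variables 1 and 2, hence
   so does beta: this makes beta a function g of alpha. *)
have /choice[g gP] a : exists b, forall s, s 1 = f -> s 2 = a ->
    computes s select (tv_and C [set b] (X a b)).
  have [||w sw [b _ wP]] := selectE (fun i => if i == 1 then f else a) a => //.
  exists b => s s1 s2; exists w => //.
  by move: sw; rewrite /= s1 s2.
have [c cE cP] : exists2 c, ev (upd (upd rho 0 h) 1 f) (lam 2 (Fst select)) c &
    forall a, ([set a] ==> [set g a]) c.
  apply: (computes_uniform (fun _ => 0)) => a; apply: computes_lam => b bE.
  by apply: computes_fst; apply: gP.
apply: (computes_app (X := [set c])); last by exists c.
apply: computes_lam => c' c'E; apply: computes_ret.
apply: (computes_bigcup (c : dom Fun)); apply: computes_pair.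
  exact: computes_var.
apply: computes_ret; apply: (computes_bigcap set0) => E.
apply: (computes_bigcap (dom0 Fun)) => a; apply: computes_lam => a' a'E.
apply: computes_ret; apply: (computes_bigcup (g a : dom Fun)).
apply: computes_pair; first by apply: computes_fst; apply: gP.
apply: computes_pair; last first.
  apply: computes_ret; apply: (computes_bigcap set0) => F.
  have -> : mu (fren (upren Fun (upren Fun (shift Fun))) A)
      (@scons dom Fun (g a) (@scons dom Fun a (@scons dom Fun c r))) F =
      mu A (@scons dom Fun (g a) (@scons dom Fun a r)) F.
    by rewrite mu_ren; congr mu; apply: env_ext => -[] // [|[|i]].
  exact: (computes_inst F (computes_snd (gP a _ (erefl f) a'E))).
apply: (computes_app (X := [set a])); last exact: computes_var.
apply: (computes_app (X := [set c])); last exact: computes_var.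
apply: computes_cst.
apply: (kappP 2 1 0 (@scons dom Fun (g a) (@scons dom Fun a (@scons dom Fun c r))) E).
by have [b cab bE] := cP a a erefl; rewrite -[X in K2app _ _ X](bE : b = g a).
Qed.

End Soundness.
End Realizers.

Theorem theorem10p4 (C : combinators) (L : signature) (N : expansion L) :
  (forall A : form L, EA A -> valid C N A) /\
  (forall A : form L, valid C N (Choice A)).
Proof.
split=> A; last by apply/holds_valid/holds_Choice.
by move=> /(holds_EA C N)/holds_valid.
Qed.
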